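(* Let $(X,x_0)$ be a pointed path connected space, let $f:(X,x_0)\to (X,x_0)$ be a continuous pointed map, and let $cst_{x_0}:X\to X$ be the constant map with value $x_0$. Then $$cat(X)\leq TC^{(f,cst_{x_0},X)}(X)\leq TC(X).$$
   Context: For a space $X$, $P(X)$ denotes the space of all continuous paths $\gamma:[0,1]\to X$ with the compact-open topology. For a path connected space $X$ and continuous maps $f,g:X\to Z$, let $X\times_Z X=\{(x,y)\in X\times X \mid f(x)=g(y)\}$, with the subspace topology. The fibred topological complexity $TC^{(f,g,Z)}(X)$ is the smallest integer $k$ for which there exist an open cover $\{U_i\}_{i=1}^k$ of $X\times_Z X$ and continuous maps $s_i:U_i\to P(X)$ such that $s_i(x,y)(0)=x$ and $s_i(x,y)(1)=y$ for all $(x,y)\in U_i$; it is $\infty$ if no such $k$ exists. Here $Z=X$ and $g=cst_{x_0}$, so $X\times_Z X=f^{-1}(\{x_0\})\times X$. Farber's topological complexity $TC(X)$ is the smallest integer $k$ for which there exist an open cover $\{U_i\}_{i=1}^k$ of $X\times X$ and continuous maps $s_i:U_i\to P(X)$ with $s_i(x,y)(0)=x$ and $s_i(x,y)(1)=y$ for all $(x,y)\in U_i$ (and $\infty$ if there is none). $cat(X)$ is the (non-reduced) Lusternik–Schnirelmann category: the smallest integer $n$ such that $X$ has an open cover $V_1,\dots,V_n$ with each inclusion $V_i\hookrightarrow X$ homotopic to a constant map (and $\infty$ if there is none). *)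

(* Defs.v *)
From HB Require Import structures.
From mathcomp Require Import all_boot all_order all_algebra.
From mathcomp Require Import all_classical all_reals topology normedtype.
Import Order.TTheory GRing.Theory Num.Theory.
Import numFieldNormedType.Exports.

Set Implicit Arguments.
Unset Strict Implicit.
Unset Printing Implicit Defensive.

Local Open Scope classical_set_scope.
Local Open Scope ring_scope.

Section unit_interval.
Variable R : realType.

Definition unit_interval : Type := ([set` `[0, 1]] : set R).

HB.instance Definition _ := Topological.on unit_interval.

Lemma I0_subproof : (0 : R) \in [set` `[0, 1] : interval R].
Proof. by apply: mem_set; rewrite /= in_itv /= lexx ler01. Qed.

Lemma I1_subproof : (1 : R) \in [set` `[0, 1] : interval R].
Proof. by apply: mem_set; rewrite /= in_itv /= lexx ler01. Qed.

Definition I0 : unit_interval := exist _ 0 I0_subproof.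
Definition I1 : unit_interval := exist _ 1 I1_subproof.

End unit_interval.

Definition path_space (R : realType) (X : topologicalType) : Type :=
  continuousType (unit_interval R) X.

(* The topology induced by the inclusion of the continuous maps into the space
   of all maps with the compact-open topology; this is the usual compact-open
   topology on continuous maps. *)
HB.instance Definition _ (R : realType) (X : topologicalType) :=
  Topological.copy (path_space R X)
    (@initial_topology (continuousType (unit_interval R) X)
       {compact-open, unit_interval R -> X} id).

Definition path_fun (R : realType) (X : topologicalType) (p : path_space R X) :
  unit_interval R -> X := (p : continuousType (unit_interval R) X).
Coercion path_fun : path_space >-> Funclass.

Definition path_connected (R : realType) (X : topologicalType) : Prop :=
  forall x y : X, exists p : path_space R X, p (I0 R) = x /\ p (I1 R) = y.

Definition homotopic (R : realType) (A B : topologicalType) (f g : A -> B) :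
    Prop :=
  exists H : A * unit_interval R -> B,
    [/\ continuous H, forall a, H (a, I0 R) = f a
      & forall a, H (a, I1 R) = g a].

Definition open_cover (E : topologicalType) (k : nat) (U : 'I_k -> set E) :
    Prop :=
  (forall i, open (U i)) /\ \bigcup_(i in [set: 'I_k]) U i = [set: E].

(* [e] records the pair of endpoints prescribed by a point of [E]. In this
   definition and below, a set used as a type denotes the corresponding sigma
   type with the subspace topology. *)
Definition motion_planner (R : realType) (X E : topologicalType)
    (e : E -> X * X) (U : set E) : Prop :=
  exists s : U -> path_space R X, continuous s /\
    forall p : U, s p (I0 R) = (e (set_val p)).1 /\
                  s p (I1 R) = (e (set_val p)).2.

(* The smallest natural number satisfying [P], or +oo if there is none. *)
Definition least (P : nat -> Prop) : \bar int :=
  match pselect (exists k, `[< P k >]) with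
  | left exP => ((ex_minn exP)%:Z)%:E
  | right _ => +oo%E
  end.

Lemma least_finE (P : nat -> Prop) (n : nat) :
  least P = (n%:Z)%:E <-> P n /\ (forall m, P m -> (n <= m)%N).
Proof.
rewrite /least; case: pselect => [exP|nP]; last first.
  by split=> // -[Pn _]; case: nP; exists n; apply/asboolP.
case: ex_minnP => k /asboolP Pk mink; split=> [[<-]|[Pn minn]].
  by split=> // m Pm; apply: mink; apply/asboolP.
congr ((_%:Z)%:E); apply/eqP; rewrite eqn_leq minn // andbT.
by apply: mink; apply/asboolP.
Qed.

Lemma least_pinftyE (P : nat -> Prop) : least P = +oo%E <-> forall n, ~ P n.
Proof.
rewrite /least; case: pselect => [exP|nP]; split=> //.
  by move=> nP; exfalso; case: exP => n /asboolP Pn; exact: nP Pn.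
by move=> _ n Pn; apply: nP; exists n; apply/asboolP.
Qed.

Definition fibre_product (X Z : topologicalType) (f g : X -> Z) : set (X * X) :=
  [set p | f p.1 = g p.2].

Definition fibred_TC (R : realType) (X Z : topologicalType) (f g : X -> Z) :
    \bar int :=
  least (fun k => exists U : 'I_k -> set (fibre_product f g), open_cover U /\
    forall i, motion_planner R (@set_val _ (fibre_product f g)) (U i)).

Definition TC (R : realType) (X : topologicalType) : \bar int :=
  least (fun k => exists U : 'I_k -> set (X * X), open_cover U /\
    forall i, motion_planner R (@idfun (X * X)) (U i)).

Definition LS_cat (R : realType) (X : topologicalType) : \bar int :=
  least (fun n => exists V : 'I_n -> set X, open_cover V /\
    forall i, exists c : X, homotopic R (@set_val _ (V i)) (cst c)).

(* Main.v *)
Require Import Defs.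
From mathcomp Require Import all_boot all_order all_algebra.
From mathcomp Require Import all_classical all_reals topology normedtype.
Local Open Scope classical_set_scope.
Local Open Scope ereal_scope.

Import Order.TTheory GRing.Theory Num.Theory numFieldNormedType.Exports.

(** Both inequalities come from pulling motion planners back along a continuous
    map: a motion planner over [U], for a map [e] assigning endpoints to the
    points of [E], restricts along any continuous [h : E' -> E] to one over
    [h @^-1` U] for [e \o h], and preimages of an open cover form an open cover
    with the same number of members.

    For the upper bound, [h] is the inclusion of the fibre product in [X * X].
    For the lower bound, [h] is [y |-> (x0, y)], which lands in the fibre
    product exactly because [f x0 = x0]. A motion planner for the endpoints
    [(x0, y)] chooses, continuously in [y], a path from [x0] to [y]; running
    these paths backwards contracts the open set to [x0].

    The one topological point is that a continuous family of paths gives a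
    jointly continuous map, which is what a homotopy must be. This is the
    exponential law, valid because the unit interval is compact Hausdorff. *)

Lemma continuous_set_val {X : topologicalType} (A : set X) :
  continuous (@set_val X A).
Proof. exact: initial_continuous. Qed.

Lemma continuous_to_subtype {E X : topologicalType} {A : set X} (g : E -> A) :
  continuous (@set_val X A \o g) -> continuous g.
Proof. exact: continuous_comp_initial. Qed.

Lemma continuous_map_snd {A B C : topologicalType} {h : B -> C} :
  continuous h -> continuous (fun z : A * B => (z.1, h z.2)).
Proof.
move=> ch z; apply: cvg_pair; first exact: cvg_fst.
exact: (continuous_comp cvg_snd (ch _)).
Qed.

(** A filter on the subtype, pushed forward to [X], contains [A], hence clusters
    at a point of [A]; since the subtype carries the initial topology, that
    point is already a cluster point of the original filter. *)
Lemma compact_subtype {X : topologicalType} {A : set X} :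
  compact A -> compact [set: A].
Proof.
move=> cA F PF _.
have FA : (set_val @ F) A.
  by apply: (@filterS _ F _ setT); [move=> x _; exact: set_valP|exact: filterT].
have [x [Ax clx]] := cA _ (fmap_proper_filter _ PF) FA.
exists (SigSub (mem_set Ax)); split=> // B C FB [D [[W oW <-] Wx] WC].
have Wn : nbhs x W by apply: open_nbhs_nbhs.
have FB' : (set_val @ F) (set_val @` B).
  by apply: (@filterS _ F _ B) => // y By; exists y.
have [_ [[b Bb <-] Wb]] := clx _ _ FB' Wn.
by exists b; split=> //; exact: WC.
Qed.

Lemma hausdorff_subtype {X : topologicalType} (A : set X) :
  hausdorff_space X -> hausdorff_space A.
Proof.
move=> hX p q clpq; apply: val_inj; apply: hX => B C Bp Cq.
have [r [Br Cr]] := clpq _ _ (continuous_set_val A p B Bp)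
                             (continuous_set_val A q C Cq).
by exists (set_val r).
Qed.

Lemma unit_interval_hausdorff (R : realType) : hausdorff_space (unit_interval R).
Proof. exact/hausdorff_subtype/Rhausdorff. Qed.

Lemma unit_interval_locally_compact (R : realType) :
  locally_compact [set: unit_interval R].
Proof.
move=> t _; rewrite withinET; exists setT; first exact: filterT.
by split; [exact/compact_subtype/segment_compact|exact: closedT].
Qed.

(** The uncurrying half of the exponential law. Near a time [t], a compact
    neighbourhood of [t] sent by [s u] into an open set stays sent into it by
    the nearby paths: this is what the compact-open topology controls. *)
Lemma path_family_continuous {R : realType} {E X : topologicalType}
    (s : E -> path_space R X) :
  continuous s -> continuous (fun z : E * unit_interval R => s z.1 z.2).
Proof.
move=> cs; pose ev u : {compact-open, unit_interval R -> X} := s u.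
have cev : continuous ev.
  move=> u; apply: (@continuous_comp E (path_space R X) _ s); first exact: cs.
  exact: initial_continuous.
have := @continuous_uncurry E (unit_interval R) X ev
  (@unit_interval_locally_compact R) (@unit_interval_hausdorff R) cev
  (fun u => @cts_fun _ _ (s u)).
rewrite (_ : uncurry ev = fun z => s z.1 z.2)//.
by apply/funext => -[].
Qed.

Lemma onem_unit_interval_subproof {R : realType} (t : unit_interval R) :
  (1 - set_val t \in [set` `[0, 1] : interval R])%R.
Proof.
have /= := set_valP t; rewrite in_itv /= => /andP[t0 t1].
by apply: mem_set; rewrite /= in_itv /= subr_ge0 t1 gerBl t0.
Qed.

Definition unit_interval_rev {R : realType} (t : unit_interval R) :
  unit_interval R := SigSub (onem_unit_interval_subproof t).

Lemma unit_interval_rev_continuous (R : realType) :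
  continuous (@unit_interval_rev R).
Proof.
have onem_continuous : continuous (fun x : R => 1 - x)%R.
  by move=> x; apply: cvgB; [exact: cvg_cst|exact: cvg_id].
apply: continuous_to_subtype => t.
exact: (continuous_comp (continuous_set_val _ t) (onem_continuous _)).
Qed.

Lemma unit_interval_rev0 (R : realType) : unit_interval_rev (I0 R) = I1 R.
Proof. by apply: val_inj; rewrite /= set_valE /= subr0. Qed.

Lemma unit_interval_rev1 (R : realType) : unit_interval_rev (I1 R) = I0 R.
Proof. by apply: val_inj; rewrite /= set_valE /= subrr. Qed.

Lemma open_cover_preimage {E' E : topologicalType} {k : nat} (h : E' -> E)
    (U : 'I_k -> set E) :
  continuous h -> open_cover U -> open_cover (fun i => h @^-1` U i).
Proof.
move=> ch [oU covU]; split=> [i|].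
  by move/continuousP: ch; apply; exact: oU.
by rewrite -preimage_bigcup covU preimage_setT.
Qed.

Lemma motion_planner_pullback {R : realType} {X E' E : topologicalType}
    (h : E' -> E) (e : E -> X * X) (U : set E) :
  continuous h -> motion_planner R e U ->
  motion_planner R (e \o h) (h @^-1` U).
Proof.
move=> ch [s [cs se]].
have hP (p : h @^-1` U) : U (h (set_val p)) by exact: (set_valP p).
pose r (p : h @^-1` U) : U := SigSub (mem_set (hP p)).
have cr : continuous r.
  apply: continuous_to_subtype => p.
  exact: (continuous_comp (continuous_set_val _ _) (ch _)).
exists (s \o r); split=> [p|p]; first exact: (continuous_comp (cr p) (cs _)).
exact: se (r p).
Qed.

(** The paths are traversed backwards: at time [0] the homotopy must be at the
    moving endpoint, at time [1] at the fixed one. *)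
Lemma motion_planner_null_homotopic {R : realType} {X : topologicalType}
    (x0 : X) (V : set X) :
  motion_planner R (fun y : X => (x0, y)) V ->
  homotopic R (@set_val _ V) (cst x0).
Proof.
move=> [s [cs se]].
exists (fun z => s z.1 (unit_interval_rev z.2)); split.
- have crev := continuous_map_snd (A := V) (unit_interval_rev_continuous R).
  move=> z.
  exact: (continuous_comp (crev z) (path_family_continuous s cs _)).
- by move=> a /=; rewrite unit_interval_rev0; case: (se a).
- by move=> a /=; rewrite unit_interval_rev1; case: (se a).
Qed.

Lemma le_least (P Q : nat -> Prop) :
  (forall k, Q k -> P k) -> least P <= least Q.
Proof.
move=> QP; rewrite {2}/least; case: pselect => [exQ|_]; last exact: leey.
case: ex_minnP => k /asboolP /QP Pk _.
rewrite /least; case: pselect => [exP|]; last first.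
  by case; exists k; apply/asboolP.
case: ex_minnP => m _ minm.
by rewrite lee_fin lez_nat; apply: minm; apply/asboolP.
Qed.

Theorem theorem3 (R : realType) (X : topologicalType) (x0 : X) (f : X -> X)
    (X_path_connected : path_connected R X)
    (f_continuous : continuous f) (f_pointed : f x0 = x0) :
  LS_cat R X <= fibred_TC R f (cst x0) /\
  fibred_TC R f (cst x0) <= TC R X.
Proof.
split; apply: le_least => k [U [covU planU]].
- have x0_fibre y : fibre_product f (cst x0) (x0, y) by [].
  pose h y : fibre_product f (cst x0) := SigSub (mem_set (x0_fibre y)).
  have ch : continuous h.
    by apply: continuous_to_subtype => y; apply: cvg_pair; [exact: cvg_cst|].
  exists (fun i => h @^-1` U i); split; first exact: open_cover_preimage.
  move=> i; exists x0; apply: motion_planner_null_homotopic.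
  exact: motion_planner_pullback (planU i).
- have ch := continuous_set_val (fibre_product f (cst x0)).
  exists (fun i => set_val @^-1` U i); split; first exact: open_cover_preimage.
  by move=> i; exact: motion_planner_pullback (planU i).
Qed.
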